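(* Let $k\ge1$ and, for each $n\ge1$, let $\boldsymbol X_n=(X_n^{(1)},\dots,X_n^{(k)})$, where $X_n^{(1)},\dots,X_n^{(k)}$ are independent and, for each $i=1,\dots,k$: (i) $X_n^{(i)}$ is a random object taking values in a metric space $(\mathcal X^{(i)},d^{(i)})$; (ii) $\{X_n^{(i)}\}_{n\ge1}$ satisfies the extended LDP on $(\mathcal X^{(i)},d^{(i)})$ with rate function $I^{(i)}$ and speed $a_n$ (the same speed for all $i$); (iii) the set of finite values taken by $I^{(i)}$ is an at most countable subset of $\mathbb{R}_+=[0,\infty)$ with no limit point. Then $\{\boldsymbol X_n\}_{n\ge1}$ satisfies the extended LDP on the product space $\big(\prod_{i=1}^k\mathcal X^{(i)},\max_{i=1}^kd^{(i)}\big)$ with speed $a_n$ and rate function $\bar I(x_1,\dots,x_k)=\sum_{i=1}^kI^{(i)}(x_i)$.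
   Context: Extended LDP: for a metric space $(S,d)$ and $A\subseteq S$ let $d(x,A)=\inf_{y\in A}d(x,y)$ and $A^\epsilon=\{x\in S:d(x,A)\le\epsilon\}$. Random elements $Y_n$ of $S$ satisfy the extended LDP on $(S,d)$ with rate function $I$ and speed $a_n\to\infty$ if $I:S\to[0,\infty]$ is lower semicontinuous and for every open $G$ and every closed $F$, $-\inf_{x\in G}I(x)\le\liminf_{n\to\infty}\frac{\log P(Y_n\in G)}{a_n}$ and $\limsup_{n\to\infty}\frac{\log P(Y_n\in F)}{a_n}\le-\lim_{\epsilon\downarrow0}\inf_{x\in F^\epsilon}I(x)$ (with $\inf\emptyset=+\infty$, $\log 0=-\infty$). *)

(* Defs.v *)
From HB Require Import structures.
From mathcomp Require Import all_boot all_order all_algebra.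
From mathcomp Require Import all_classical all_reals all_analysis.

Set Implicit Arguments.
Unset Strict Implicit.
Unset Printing Implicit Defensive.

Import Order.TTheory GRing.Theory Num.Theory.
Import numFieldNormedType.Exports.

Local Open Scope classical_set_scope.
Local Open Scope ring_scope.

(* An alias of the dependent product, which keeps the max metric apart from
   the topology that the library puts on bare function types. *)
Definition max_prod (R : realType) (k : nat) (T : 'I_k -> metricType R) : Type :=
  forall i : 'I_k, T i.

Section max_prod_metric.
Context {R : realType} {k : nat} (T : 'I_k -> metricType R).

(* The default 0 is harmless because distances are nonnegative. *)
Definition max_dist (x y : max_prod T) : R :=
  \big[Num.max/0]_(i < k) mdist (x i) (y i).

Lemma max_dist_ge0 x y : 0 <= max_dist x y.
Proof. exact: bigmax_ge_id. Qed.

Lemma mdist_le_max_dist x y i : mdist (x i) (y i) <= max_dist x y.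
Proof. exact: le_bigmax. Qed.

Lemma max_distxx x : max_dist x x = 0.
Proof.
apply/eqP; rewrite eq_le max_dist_ge0 andbT.
by apply: bigmax_le => // i _; rewrite mdistxx.
Qed.

Lemma max_dist_positivity x y : max_dist x y = 0 -> x = y.
Proof.
move=> xy0; apply: functional_extensionality_dep => i; apply: mdist_positivity.
apply/eqP; rewrite eq_le mdist_ge0 andbT -xy0; exact: mdist_le_max_dist.
Qed.

Lemma max_dist_sym x y : max_dist x y = max_dist y x.
Proof. by apply: eq_bigr => i _; exact: metric_sym. Qed.

Lemma max_dist_triangle y x z : max_dist x z <= max_dist x y + max_dist y z.
Proof.
apply: bigmax_le => [|i _]; first by rewrite addr_ge0 ?max_dist_ge0.
by rewrite (le_trans (metric_triangle _ (y i) _))// lerD// mdist_le_max_dist.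
Qed.

HB.instance Definition _ := gen_eqMixin (max_prod T).
HB.instance Definition _ := gen_choiceMixin (max_prod T).
HB.instance Definition _ := @isMetric.Build R (max_prod T) max_dist
  max_distxx max_dist_positivity max_dist_sym max_dist_triangle.

End max_prod_metric.

Section random_elements.
Context {R : realType} {d : measure_display} {Omega : measurableType d}.

Definition random_element (S : topologicalType) (Y : Omega -> S) : Prop :=
  forall A : set S, <<s @open S >> A -> measurable (Y @^-1` A).

Definition independent_elements (P : probability Omega R) (I : finType)
    (S : I -> topologicalType) (Y : forall i, Omega -> S i) : Prop :=
  forall (J : {set I}) (A : forall i, set (S i)),
    (forall i, i \in J -> <<s @open (S i) >> (A i)) ->
    (P (\bigcap_(i in [set` J]) (Y i @^-1` A i)) =
     \prod_(i in J) P (Y i @^-1` A i))%E.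

End random_elements.

Section extended_LDP.
Context {R : realType}.
Local Open Scope ereal_scope.

(* As an infimum in \bar R, this is +oo when A is empty. *)
Definition dist_set (S : metricType R) (x : S) (A : set S) : \bar R :=
  ereal_inf [set (mdist x y)%:E | y in A].

Definition fattening (S : metricType R) (A : set S) (e : R) : set S :=
  [set x | dist_set x A <= e%:E].

Definition rate_function (S : topologicalType) (I : S -> \bar R) : Prop :=
  (forall x, 0 <= I x) /\ lower_semicontinuous I.

(* [lne 0 = -oo].  The value of a quotient at an index where [a n] is 0 does
   not matter, since [a] tends to infinity. *)
Definition extended_LDP (d : measure_display) (Omega : measurableType d)
    (P : probability Omega R) (S : metricType R) (Y : nat -> Omega -> S)
    (I : S -> \bar R) (a : nat -> R) : Prop :=
  [/\ a n @[n --> \oo] --> (+oo)%R,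
      rate_function I,
      forall G : set S, open G ->
        - ereal_inf (I @` G) <=
        limn_einf (fun n => lne (P (Y n @^-1` G)) / (a n)%:E) &
      forall F : set S, closed F ->
        limn_esup (fun n => lne (P (Y n @^-1` F)) / (a n)%:E) <=
        - lim (ereal_inf (I @` fattening F e) @[e --> 0%R^'+])].

Definition finite_values (S : Type) (I : S -> \bar R) : set R :=
  [set r | exists x, I x = r%:E].

End extended_LDP.

(* Main.v *)
(* The lower bound is the independence of the coordinates applied to small
   boxes inside the open set.  For the upper bound, let F be closed and let the
   product rate exceed M' on the d-fattening of F.  For each real v, the set C_i(v)
   of points at distance >= d from {I_i < v} is closed, and the one-dimensional
   upper bound gives it probability at most exp(-a_n (v - o(1))).  If X is in
   F, let j_i <= N be maximal with X_i in C_i(j_i eta).  Either some j_i is N,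
   or every X_i is within d of a point y_i with I_i(y_i) < (j_i + 1) eta; then
   y lies in the fattening of F, so that sum_i j_i eta > M' - k eta.  A union
   bound over the finitely many grid points j, with independence, gives the
   result as eta -> 0. *)
Require Import Defs.
From HB Require Import structures.
From mathcomp Require Import all_boot all_order all_algebra.
From mathcomp Require Import all_classical all_reals all_analysis.
From mathcomp Require Import ring lra.

Set Implicit Arguments.
Unset Strict Implicit.
Unset Printing Implicit Defensive.

Import Order.TTheory GRing.Theory Num.Theory.
Import numFieldNormedType.Exports.

Local Open Scope classical_set_scope.
Local Open Scope ring_scope.

(** * Logarithmic limits in exponential form, and semicontinuity of sums *)

Section limits.
Context {R : realType}.
Implicit Types (u p : nat -> \bar R) (a : nat -> R).
Local Open Scope ereal_scope.

Lemma limn_esup_lt_near u l : limn_esup u < l -> \forall n \near \oo, u n < l.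
Proof.
move=> /ereal_inf_lt[_ [V V_oo <-]] uVl; apply: filterS V_oo => n Vn.
by apply: le_lt_trans uVl; apply: ereal_sup_ubound; exists n.
Qed.

Lemma near_le_limn_esup u l : (\forall n \near \oo, u n <= l) -> limn_esup u <= l.
Proof.
move=> ul; apply: ereal_inf_le; exists (ereal_sup (u @` [set n | u n <= l])).
  by exists [set n | u n <= l].
by apply: ge_ereal_sup => _ [n uln <-].
Qed.

Lemma limn_einf_gt_near u l : l < limn_einf u -> \forall n \near \oo, l < u n.
Proof.
rewrite /limn_einf lteNr => /limn_esup_lt_near; apply: filterS => n.
by rewrite lteN2.
Qed.

Lemma near_ge_limn_einf u l : (\forall n \near \oo, l <= u n) -> l <= limn_einf u.
Proof.
move=> ul; rewrite /limn_einf leeNr; apply: near_le_limn_esup.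
by apply: filterS ul => n; rewrite leeN2.
Qed.

(** Probability 0 is covered: [lne 0] is [-oo], which [expeR] sends back to 0. *)
Lemma lne_div_le (p : \bar R) (b c : R) : 0 <= p -> (0 < b)%R ->
  (lne p / b%:E <= c%:E) = (p <= (expR (b * c))%:E).
Proof.
move=> p0 b0; rewrite inver gt_eqF// lee_pdivrMr//.
rewrite -[in LHS]lee_expeR (eqP (_ : expeR (lne p) == p)) ?lneK_eq//.
by rewrite -EFinM mulrC.
Qed.

Lemma lne_div_ge (p : \bar R) (b c : R) : 0 <= p -> (0 < b)%R ->
  (c%:E <= lne p / b%:E) = ((expR (b * c))%:E <= p).
Proof.
move=> p0 b0; rewrite inver gt_eqF// lee_pdivlMr//.
rewrite -[in LHS]lee_expeR (eqP (_ : expeR (lne p) == p)) ?lneK_eq//.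
by rewrite -EFinM mulrC.
Qed.

(** Trades logarithms for exponential bounds with an arbitrary loss [e], which can be summed and
    multiplied. Only indices with [a n > 0] matter, and these are eventually all of them. *)
Lemma limn_esup_lne_le a p (c : R) : a n @[n --> \oo] --> +oo%R ->
    (forall n, 0 <= p n) ->
  limn_esup (fun n => lne (p n) / (a n)%:E) <= c%:E <->
  forall e : R, (0 < e)%R ->
    \forall n \near \oo, p n <= (expR (a n * (c + e)))%:E.
Proof.
move=> a_oo p0; split=> [pc e e0|pc].
  have /limn_esup_lt_near : limn_esup (fun n => lne (p n) / (a n)%:E) < (c + e)%:E.
    by rewrite (le_lt_trans pc)// lte_fin ltrDl.
  apply: filterS2 (cvgry_gt a_oo 0%R) => n an0 /ltW.
  by rewrite lne_div_le.
apply/lee_addgt0Pr => e /pc pce; apply: near_le_limn_esup.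
apply: filterS2 (cvgry_gt a_oo 0%R) pce => n an0.
by rewrite -EFinD lne_div_le.
Qed.

Lemma limn_einf_lne_ge a p (c : R) : a n @[n --> \oo] --> +oo%R ->
    (forall n, 0 <= p n) ->
  c%:E <= limn_einf (fun n => lne (p n) / (a n)%:E) <->
  forall e : R, (0 < e)%R ->
    \forall n \near \oo, (expR (a n * (c - e)))%:E <= p n.
Proof.
move=> a_oo p0; split=> [pc e e0|pc].
  have /limn_einf_gt_near : (c - e)%:E < limn_einf (fun n => lne (p n) / (a n)%:E).
    by rewrite (lt_le_trans _ pc)// lte_fin gtrBl.
  apply: filterS2 (cvgry_gt a_oo 0%R) => n an0 /ltW.
  by rewrite lne_div_ge.
apply/lee_subgt0Pr => e /pc pce; apply: near_ge_limn_einf.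
apply: filterS2 (cvgry_gt a_oo 0%R) pce => n an0.
by rewrite -EFinB lne_div_ge.
Qed.

(** A fixed number of terms costs nothing on the exponential scale: once [a n >= m / (c - b)], the
    inequality [1 + t <= expR t] gives [m <= expR (a n * (c - b))]. *)
Lemma near_mulrn_expR_le a (m : nat) (b c : R) : a n @[n --> \oo] --> +oo%R ->
  (b < c)%R ->
  \forall n \near \oo, (expR (a n * b) *+ m <= expR (a n * c))%R.
Proof.
move=> a_oo bc; have cb0 : (0 < c - b)%R by rewrite subr_gt0.
apply: filterS (cvgry_ge a_oo (m%:R / (c - b))%R) => n.
rewrite ler_pdivrMr// => mn.
rewrite -[leLHS]mulr_natl -[leRHS]mulr1 -{2}(expRxMexpNx_1 (a n * b)) mulrCA [leRHS]mulrC.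
rewrite ler_wpM2r ?expR_ge0// -expRD -mulrN -mulrDr.
by rewrite (le_trans mn)// (le_trans _ (expR_ge1Dx _))// lerDr.
Qed.

Lemma lee_prod (J : Type) (s : seq J) (f g : J -> \bar R) :
  (forall i, 0 <= f i) -> (forall i, f i <= g i) ->
  \prod_(i <- s) f i <= \prod_(i <- s) g i.
Proof.
move=> f0 fg.
(* Nonnegativity is carried through the induction because multiplying inequalities requires it. *)
suff : 0 <= \prod_(i <- s) f i /\ \prod_(i <- s) f i <= \prod_(i <- s) g i by case.
elim/big_ind2 : _ => // x1 y1 x2 y2 [x10 xy1] [x20 xy2].
by rewrite mule_ge0// lee_pmul.
Qed.

Lemma lower_semicontinuousD (S : topologicalType) (f g : S -> \bar R) :
  (forall x, 0 <= f x) -> (forall x, 0 <= g x) ->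
  lower_semicontinuous f -> lower_semicontinuous g ->
  lower_semicontinuous (f \+ g).
Proof.
move=> f0 g0 lf lg x c cfg.
(* The level [c] is split between [f] and [g]. If both values are finite, each gives up half of the
   slack [f x + g x - c]; an infinite value absorbs the rest. *)
have [b bf bg] : exists2 b : R, b%:E < f x & (c - b)%:E < g x.
  move: (f x) (g x) (f0 x) (g0 x) cfg => [r| |] [s| |]//= r0 s0.
  - rewrite -EFinD lte_fin => crs; exists (r - (r + s - c) / 2)%R.
      by rewrite lte_fin gtrBl divr_gt0// subr_gt0.
    rewrite lte_fin -subr_gt0; have -> : (s - (c - (r - (r + s - c) / 2)) =
      (r + s - c) / 2)%R by field.
    by rewrite divr_gt0// subr_gt0.
  - by move=> _; exists (r - 1)%R; rewrite ?ltry// lte_fin gtrBl.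
  - move=> _; exists (c - s + 1)%R; rewrite ?ltry// lte_fin.
    by rewrite opprD opprB addrA addrC !addrA [(- 1 + c)%R]addrC; lra.
  - by move=> _; exists 0%R; rewrite ?ltry.
have [U xU Uf] := lf _ _ bf; have [V xV Vg] := lg _ _ bg.
exists (U `&` V) => [|y [/Uf bfy /Vg bgy]]; first exact: filterI.
by rewrite (_ : c = b + (c - b))%R ?EFinD ?lteD// addrC subrK.
Qed.

Lemma lower_semicontinuous_sum (S : topologicalType) (J : Type) (s : seq J)
    (f : J -> S -> \bar R) :
  (forall i x, 0 <= f i x) -> (forall i, lower_semicontinuous (f i)) ->
  lower_semicontinuous (fun x => \sum_(i <- s) f i x).
Proof.
move=> f0 lf; elim: s => [x c|i s IHs].
  rewrite big_nil => c0; exists setT; first exact: filterT.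
  by move=> y _; rewrite big_nil.
under eq_fun do rewrite big_cons.
by apply: lower_semicontinuousD => // x; apply: sume_ge0.
Qed.

End limits.

(** * Fattenings, and sets far from a sublevel set *)

Section fattening.
Context {R : realType} (S : metricType R).
Implicit Types (I : S -> \bar R) (F : set S).
Local Open Scope ereal_scope.

Lemma fattening_mdist (e : R) F x y : F y -> (mdist x y <= e)%R ->
  fattening F e x.
Proof.
move=> Fy xye; have : (mdist x y)%:E <= e%:E by rewrite lee_fin.
by apply: le_trans; apply: ereal_inf_lbound; exists y.
Qed.

(** The infimum defining the distance need not be attained, hence the strictly larger radius. *)
Lemma fattening_exists (e d : R) F x : (e < d)%R -> fattening F e x ->
  exists2 y, F y & (mdist x y < d)%R.
Proof.
move=> ed xFe; have : dist_set x F < d%:E by rewrite (le_lt_trans xFe)// lte_fin.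
by move=> /ereal_inf_lt[_ [y Fy <-]]; rewrite lte_fin => xyd; exists y.
Qed.

Lemma is_cvg_inf_fattening I F :
  cvg (ereal_inf (I @` fattening F e) @[e --> 0%R^'+]).
Proof.
apply: nonincreasing_at_right_is_cvge; apply: nearW => b x y _ _ xy.
apply: ereal_inf_le_tmp => _ [z zFx <-]; exists z => //.
by rewrite /fattening/= (le_trans zFx)// lee_fin.
Qed.

Lemma lt_lim_inf_fattening I F (M : R) :
    M%:E < lim (ereal_inf (I @` fattening F e) @[e --> 0%R^'+]) ->
  exists2 d : R, (0 < d)%R & forall x, fattening F d x -> M%:E < I x.
Proof.
move=> MI.
have : \forall e \near 0%R^'+, M%:E < ereal_inf (I @` fattening F e).
  apply: (@is_cvg_inf_fattening I F [set l | M%:E < l]).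
  exact: (open_nbhs_nbhs (conj (@open_ereal_gt_ereal _ _) MI)).
move=> MIe.
have /filter_ex[d [d0 Id]] : \forall d \near 0%R^'+,
    (0 < d)%R /\ M%:E < ereal_inf (I @` fattening F d).
  by apply: filterS2 (nbhs_right_gt 0%R) MIe.
exists d => // x Fx; apply: (lt_le_trans Id); apply: ereal_inf_lbound.
by exists x.
Qed.

(** Stated pointwise rather than with [dist_set], so that an empty sublevel set gives the whole
    space. *)
Definition far_from_sublevel I (v d : R) : set S :=
  [set x | forall y, I y < v%:E -> (d <= mdist x y)%R].

Lemma closed_far_from_sublevel I v d : closed (far_from_sublevel I v d).
Proof.
move=> x xcl y yv; apply/ler_addgt0Pl => e e0.
have [z [zfar]] := xcl _ (nbhsx_ballx x _ e0).
rewrite ballEmdist/= => xze; rewrite (le_trans (zfar _ yv))//.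
by rewrite (le_trans (metric_triangle z x y))// lerD2r metric_sym ltW.
Qed.

(** For [e < d], a point of the [e]-fattening is closer than [d] to a point of the far set, so it
    cannot itself lie in the sublevel set. *)
Lemma le_lim_inf_fattening_far I (v d : R) : (0 < d)%R ->
  v%:E <= lim (ereal_inf (I @` fattening (far_from_sublevel I v d) e)
                @[e --> 0%R^'+]).
Proof.
move=> d0; apply: lime_ge; first exact: is_cvg_inf_fattening.
apply: filterS (nbhs_right_lt d0) => e ed.
apply: le_ereal_inf_tmp => _ [x xe <-]; rewrite leNgt; apply/negP => Ixv.
have [y + xyd] := fattening_exists ed xe.
by move=> /(_ _ Ixv); rewrite metric_sym leNgt xyd.
Qed.

(** A maximal far level exists because level 0 qualifies, its sublevel set being empty. Failure of
    level [j.+1] provides the nearby [y]; at [j = N] there is no next level to test. *)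
Lemma grid_level I (eta d : R) (N : nat) x : (forall y, 0 <= I y) ->
  exists j : 'I_N.+1, far_from_sublevel I (j%:R * eta) d x /\
    ((j < N)%N -> exists2 y, I y < (j.+1%:R * eta)%:E & (mdist x y < d)%R).
Proof.
move=> I0.
have far0 : `[< far_from_sublevel I ((ord0 : 'I_N.+1)%:R * eta) d x >].
  by apply/asboolP => y; rewrite mul0r ltNge I0.
pose far (j : 'I_N.+1) := `[< far_from_sublevel I (j%:R * eta) d x >].
case: (arg_maxnP (P := far) (fun j : 'I_N.+1 => j : nat) far0).
move=> j /asboolP farj jmax; exists j; split=> // jN.
have jN1 : (j.+1 < N.+1)%N by [].
have : ~ far (Ordinal jN1).
  by move=> /jmax /=; rewrite ltnn.
move=> /negP/asboolPn/existsNP[y] /not_implyP[Iy /negP]; rewrite -ltNge => xy.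
by exists y.
Qed.

End fattening.

(** * The product rate function and the grid covering *)

Section max_prod_lemmas.
Context {R : realType} {k : nat} (T : 'I_k -> metricType R).
Local Open Scope ereal_scope.

Lemma mdist_max_prod_lt (x y : max_prod T) (d : R) : (0 < d)%R ->
  (forall i, mdist (x i) (y i) < d)%R -> (mdist x y < d)%R.
Proof. by move=> d0 xyd; apply: bigmax_lt => // i _. Qed.

Lemma rate_function_max_prod (I : forall i, T i -> \bar R) :
    (forall i, rate_function (I i)) ->
  rate_function (fun x : max_prod T => \sum_(i < k) I i (x i)).
Proof.
move=> rI; have I0 i x : 0 <= I i x by case: (rI i) => + _; apply.
split=> [x|]; first by apply: sume_ge0.
apply: lower_semicontinuous_sum => // i x c cI.
(* Coordinates are 1-Lipschitz for the max metric, so the same radius serves in the product. *)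
have [V /nbhs_ballP[d /= d0 xdV] VI] := (rI i).2 _ _ cI.
exists (ball x d) => [|y]; first exact: nbhsx_ballx.
rewrite ballEmdist/= => xyd; apply/VI/xdV; rewrite ballEmdist/=.
by rewrite (le_lt_trans _ xyd)//; exact: mdist_le_max_dist.
Qed.

(** The gap between [M] and [M'] pays for rounding up by one grid step in each of the [k]
    coordinates. *)
Lemma grid_cover (I : forall i, T i -> \bar R) (F : set (max_prod T))
    (M M' eta d : R) (N : nat) (x : max_prod T) :
    (forall i y, 0 <= I i y) -> (0 <= eta)%R -> (M + k%:R * eta <= M')%R ->
    (M <= N%:R * eta)%R -> (0 < d)%R ->
    (forall y : max_prod T, fattening F d y -> M'%:E < \sum_(i < k) I i (y i)) ->
    F x ->
  exists2 j : {ffun 'I_k -> 'I_N.+1}, (M <= \sum_(i < k) (j i)%:R * eta)%R &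
    forall i, far_from_sublevel (I i) ((j i)%:R * eta) d (x i).
Proof.
move=> I0 eta0 MM' MN d0 FM' Fx.
have /fin_all_exists[j jP] i := grid_level eta d N (x i) (I0 i).
exists (finfun j) => [|i]; last by rewrite ffunE; case: (jP i).
under eq_bigr do rewrite ffunE.
(* One coordinate at the top level already contributes [N * eta >= M], the others being
   nonnegative. *)
have [[i jiN]|jN] := pselect (exists i, j i = N :> nat).
  rewrite (le_trans MN)// (bigD1 i)//= jiN lerDl.
  by apply: sumr_ge0 => l _; rewrite mulr_ge0.
have /fin_all_exists[y yP] i :
    exists y, I i y < ((j i).+1%:R * eta)%:E /\ (mdist (x i) y < d)%R.
  have [_] := jP i; case=> [|y]; last by exists y.
  by rewrite ltn_neqAle -ltnS ltn_ord andbT; apply/eqP => jiN; apply: jN; exists i.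
have /FM' : fattening F d (y : max_prod T).
  apply: fattening_mdist Fx _; rewrite metric_sym ltW//.
  by apply: mdist_max_prod_lt => // i; case: (yP i).
move=> /lt_le_trans/(_ (lee_sum _ (fun i _ => ltW (yP i).1))).
rewrite sumEFin lte_fin => /(le_lt_trans MM').
have -> : (\sum_(i < k) (j i).+1%:R * eta =
    \sum_(i < k) (j i)%:R * eta + k%:R * eta)%R.
  under eq_bigr do rewrite -natr1 mulrDl mul1r.
  by rewrite big_split/= sumr_const card_ord mulr_natl.
by rewrite ltrD2r => /ltW.
Qed.

End max_prod_lemmas.

(** * Union bound, measurability and independence *)

Section probability_lemmas.
Context {R : realType} {d : measure_display} {Omega : measurableType d}.
Variable P : probability Omega R.
Local Open Scope ereal_scope.

Lemma measure_le_sum_cover (J : finType) (D : pred J) (F : set Omega)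
    (A : J -> set Omega) :
    measurable F -> (forall j, measurable (A j)) ->
    F `<=` [set w | exists2 j, D j & A j w] ->
  P F <= \sum_(j | D j) P (A j).
Proof.
move=> mF mA FA.
pose U s := \big[setU/set0]_(j <- s | D j) A j.
have mU s : measurable (U s) by apply: bigsetU_measurable.
apply: (@le_trans _ _ (P (U (index_enum J)))).
  apply: le_measure; rewrite ?inE// => w /FA[j Dj Ajw].
  by rewrite /U (bigD1 j)//=; left.
rewrite /U; elim: (index_enum J) => [|j s IHs]; first by rewrite !big_nil measure0.
rewrite !big_cons; case: ifP => // Dj; apply: (le_trans (measureU2 _ _ _)) => //.
  exact: mU.
by rewrite leeD2l.
Qed.

Lemma random_element_closed (S : topologicalType) (Y : Omega -> S) (F : set S) :
  random_element Y -> closed F -> measurable (Y @^-1` F).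
Proof.
move=> mY cF; rewrite -[F]setCK -preimage_setC; apply/measurableC/mY.
by apply: sub_sigma_algebra; exact: closed_openC.
Qed.

Lemma independent_preimage (k : nat) (S : 'I_k -> topologicalType)
    (Y : forall i, Omega -> S i) (A : forall i, set (S i)) :
    independent_elements P Y -> (forall i, <<s @open (S i) >> (A i)) ->
  P [set w | forall i, A i (Y i w)] = \prod_(i < k) P (Y i @^-1` A i).
Proof.
move=> /(_ [set: 'I_k]%SET A) indY sA.
rewrite (_ : [set w | _] =
    \bigcap_(i in [set` [set: 'I_k]%SET]) (Y i @^-1` A i)).
  by rewrite indY//; apply: eq_bigl => i; rewrite inE.
by apply/seteqP; split=> w wA i => [_|]; apply: wA; rewrite /= ?inE.
Qed.

End probability_lemmas.

Lemma sigma_open_closed (S : topologicalType) (F : set S) :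
  closed F -> <<s @open S >> F.
Proof.
move=> cF; rewrite -[F]setCK -setTD; apply: sigma_algebraCD.
by apply: sub_sigma_algebra; exact: closed_openC.
Qed.

(** Shares a budget [t] among [k] coordinates; the denominator [k.+1] is always positive. *)
Lemma natr_mul_div_succ_le (R : realFieldType) (k : nat) (t : R) : 0 <= t ->
  k%:R * (t / k.+1%:R) <= t.
Proof.
move=> t0; rewrite mulrCA ler_piMr//.
by rewrite ler_pdivrMr ?ltr0n// mul1r ler_nat.
Qed.

(** * Lower and upper bounds for the product sequence *)

Section product_LDP.
Context {R : realType} {d : measure_display} {Omega : measurableType d}.
Context (P : probability Omega R) (k : nat) (T : 'I_k -> metricType R).
Context (X : nat -> forall i : 'I_k, Omega -> T i) (a : nat -> R).
Hypothesis indX : forall n, (1 <= n)%N -> independent_elements P (X n).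
Hypothesis mX : forall n, (1 <= n)%N -> forall i, random_element (X n i).
Hypothesis mXT : forall n, (1 <= n)%N ->
  random_element (fun w => (fun i => X n i w) : max_prod T).
Hypothesis a_oo : a n @[n --> \oo] --> +oo.
Local Open Scope ereal_scope.

Let Y n w : max_prod T := fun i => X n i w.

(** Boxes are handled coordinatewise through [mX]. General open and closed sets go through [mXT],
    since without separability they may lie outside the product sigma-algebra. *)
Let measurable_box n (A : forall i, set (T i)) : (1 <= n)%N ->
  (forall i, <<s @open (T i) >> (A i)) ->
  measurable [set w | forall i, A i (X n i w)].
Proof.
move=> n1 sA; rewrite (_ : [set w | _] =
    \bigcap_(i in [set: 'I_k]) (X n i @^-1` A i)); last first.
  by apply/seteqP; split=> w wA i => [_|]; apply: wA.
by apply: fin_bigcap_measurable => // i _; exact: mX.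
Qed.

Lemma max_prod_lower_bound (G : set (max_prod T)) (x : max_prod T)
    (r : 'I_k -> R) : open G -> G x ->
    (forall i B, open B -> B (x i) ->
      (- r i)%:E <= limn_einf (fun n => lne (P (X n i @^-1` B)) / (a n)%:E)) ->
  - (\sum_(i < k) (r i)%:E) <=
    limn_einf (fun n => lne (P (Y n @^-1` G)) / (a n)%:E).
Proof.
move=> oG Gx XB; rewrite sumEFin -EFinN; apply/limn_einf_lne_ge => // e e0.
have /nbhs_ballP[c /= c0 xcG] : nbhs x G by exact: open_nbhs_nbhs.
(* These open boxes sit inside the [c]-ball of the max metric, hence inside [G]. Each factor loses
   [e / k.+1] in the exponent, at most [e] in total. *)
pose B i := (ball (x i) c)°.
have oB i : open (B i) by exact: open_interior.
have sB i : <<s @open (T i) >> (B i) by apply: sub_sigma_algebra; exact: oB.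
have th0 : (0 < e / k.+1%:R)%R by rewrite divr_gt0.
have PB : \forall n \near \oo, forall i,
    (expR (a n * (- r i - e / k.+1%:R)))%:E <= P (X n i @^-1` B i).
  apply: filter_forall => i; have := XB i _ (oB i) (nbhs_singleton (nbhs_interior (nbhsx_ballx _ _ c0))).
  by move/limn_einf_lne_ge; apply.
near=> n.
have n1 : (1 <= n)%N by near: n; exact: nbhs_infty_ge.
have an0 : (0 < a n)%R by near: n; exact: cvgry_gt.
apply: (@le_trans _ _ (P [set w | forall i, B i (X n i w)])); last first.
  apply: le_measure; rewrite ?inE; first exact: measurable_box.
    by apply: mXT => //; apply: sub_sigma_algebra.
  move=> w Bw; apply: xcG; rewrite ballEmdist/=; apply: mdist_max_prod_lt => // i.
  by have /interior_subset := Bw i; rewrite ballEmdist.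
rewrite (independent_preimage (indX n1) sB).
apply: (@le_trans _ _ (\prod_(i < k) (expR (a n * (- r i - e / k.+1%:R)))%:E)).
  rewrite prodEFin -expR_sum lee_fin ler_expR -mulr_sumr ler_pM2l//.
  rewrite sumrB sumrN sumr_const card_ord lerD2l lerN2 -[leLHS]mulr_natl.
  by rewrite natr_mul_div_succ_le// ltW.
apply: lee_prod => i; first by rewrite lee_fin expR_ge0.
by move: i; near: n.
Unshelve. all: by end_near. Qed.

Lemma max_prod_upper_bound (I : forall i, T i -> \bar R)
    (F : set (max_prod T)) (M M' : R) :
    (forall i y, 0 <= I i y) -> closed F ->
    (forall i (A : set (T i)), closed A ->
      limn_esup (fun n => lne (P (X n i @^-1` A)) / (a n)%:E) <=
      - lim (ereal_inf (I i @` fattening A e) @[e --> 0%R^'+])) ->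
    (M < M')%R ->
    M'%:E < lim (ereal_inf ((fun x : max_prod T => \sum_(i < k) I i (x i)) @`
                   fattening F e) @[e --> 0%R^'+]) ->
  limn_esup (fun n => lne (P (Y n @^-1` F)) / (a n)%:E) <= (- M)%:E.
Proof.
move=> I0 cF XA MM' /lt_lim_inf_fattening[c c0 FM'].
apply/limn_esup_lne_le => // e e0.
(* Chosen so that [k] grid steps fit in the gap [M' - M]; [N] is then large enough for the grid to
   reach [M]. *)
pose eta := ((M' - M) / k.+1%:R)%R.
have eta0 : (0 < eta)%R by rewrite divr_gt0 ?subr_gt0.
pose N := (Num.trunc (M / eta)).+1.
have MN : (M <= N%:R * eta)%R by rewrite -ler_pdivrMr// ltW// truncnS_gt.
pose D (j : {ffun 'I_k -> 'I_N.+1}) := (M <= \sum_(i < k) (j i)%:R * eta)%R.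
pose C (j : {ffun 'I_k -> 'I_N.+1}) i := far_from_sublevel (I i) ((j i)%:R * eta) c.
have cC j i : closed (C j i) by exact: closed_far_from_sublevel.
have sC j i : <<s @open (T i) >> (C j i) by exact: sigma_open_closed.
(* Half of [e] is shared by the coordinate estimates; the other half absorbs the number of grid
   points. *)
pose th := (e / 2 / k.+1%:R)%R.
have th0 : (0 < th)%R by rewrite !divr_gt0.
have PC : \forall n \near \oo, forall j i,
    P (X n i @^-1` C j i) <= (expR (a n * (- ((j i)%:R * eta) + th)))%:E.
  apply: filter_forall => j; apply: filter_forall => i.
  apply: (limn_esup_lne_le _ a_oo _).1 th0 => //.
  apply: (le_trans (XA _ _ (cC j i))).
  by rewrite EFinN leeN2; exact: le_lim_inf_fattening_far.
have kth : (k%:R * th <= e / 2)%R by rewrite natr_mul_div_succ_le// divr_ge0// ltW.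
near=> n.
have n1 : (1 <= n)%N by near: n; exact: nbhs_infty_ge.
have an0 : (0 < a n)%R by near: n; exact: cvgry_gt.
apply: (@le_trans _ _ (\sum_(j | D j) P [set w | forall i, C j i (X n i w)])).
  apply: measure_le_sum_cover => [|j|w Fw].
  - by apply: random_element_closed => //; exact: mXT.
  - exact: measurable_box.
  - have MkM' : (M + k%:R * eta <= M')%R.
      by rewrite -lerBrDl natr_mul_div_succ_le// subr_ge0 ltW.
    by have [j] := grid_cover I0 (ltW eta0) MkM' MN c0 FM' Fw; exists j.
apply: (@le_trans _ _ (\sum_(j | D j) (expR (a n * (- M + e / 2)))%:E)).
  apply: lee_sum => j Dj; rewrite (independent_preimage (indX n1) (sC j)).
  apply: (@le_trans _ _
      (\prod_(i < k) (expR (a n * (- ((j i)%:R * eta) + th)))%:E)).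
    apply: lee_prod => i //.
    by move: j i {Dj}; near: n.
  rewrite prodEFin -expR_sum lee_fin ler_expR -mulr_sumr ler_pM2l//.
  by rewrite big_split/= sumrN sumr_const card_ord -[(th *+ _)%R]mulr_natl lerD// lerN2.
rewrite sumEFin lee_fin sumr_const; near: n.
by apply: near_mulrn_expR_le => //; rewrite ltrD2l ltr_pdivrMr// ltr_pMr// ltr1n.
Unshelve. all: by end_near. Qed.

End product_LDP.

(** * From the two bounds to the extended LDP *)

Theorem proposition3p1 (R : realType) (d : measure_display)
    (Omega : measurableType d) (P : probability Omega R)
    (k : nat) (T : 'I_k -> metricType R)
    (X : nat -> forall i : 'I_k, Omega -> T i)
    (I : forall i : 'I_k, T i -> \bar R) (a : nat -> R) :
  (1 <= k)%N ->
  (forall n, (1 <= n)%N -> independent_elements P (X n)) ->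
  (forall n, (1 <= n)%N -> forall i, random_element (X n i)) ->
  (forall n, (1 <= n)%N ->
    random_element (fun w => (fun i => X n i w) : max_prod T)) ->
  (forall i, extended_LDP P (fun n => X n i) (I i) a) ->
  (forall i, [/\ countable (finite_values (I i)),
                 finite_values (I i) `<=` [set r | 0 <= r] &
                 limit_point (finite_values (I i)) = set0]) ->
  extended_LDP P (fun n w => (fun i => X n i w) : max_prod T)
    (fun x : max_prod T => (\sum_(i < k) I i (x i))%E) a.
Proof.
move=> k_ge1 indX mX mXT ldpX _.
have rI i : rate_function (I i) by case: (ldpX i).
have I0 i x : (0 <= I i x)%E by case: (rI i) => + _; apply.
have a_oo : a n @[n --> \oo] --> +oo by case: (ldpX (Ordinal k_ge1)).
split=> // [|G oG|F cF]; first exact: rate_function_max_prod.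
  rewrite leeNl; apply: le_ereal_inf_tmp => _ [x Gx <-]; rewrite leeNl.
  (* An infinite coordinate rate makes the bound at [x] equal to [-oo]; otherwise all rates at [x]
     are real. *)
  have [[i Iioo]|Ifin] := pselect (exists i, I i (x i) = +oo%E).
    rewrite (_ : \sum_(i < k) _ = +oo)%E ?leNye//.
    apply/esum_eqyP => [j _|]; first by rewrite gt_eqF// (lt_le_trans _ (I0 _ _)).
    by exists i; rewrite mem_index_enum.
  have /fin_all_exists[r rI'] i : exists r : R, I i (x i) = r%:E.
    have := I0 i (x i); case Ix: (I i (x i)) => [s| |]// _; first by exists s.
    by case: Ifin; exists i.
  rewrite (eq_bigr (fun i => (r i)%:E)) => [|i _]; last exact: rI'.
  apply: max_prod_lower_bound oG Gx _ => // i B oB Bx.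
  have [_ _ ldpG _] := ldpX i; apply: le_trans (ldpG B oB).
  by rewrite EFinN leeN2 -rI'; apply: ereal_inf_lbound; exists (x i).
have upper (M M' : R) := max_prod_upper_bound indX mX mXT a_oo I0 cF
  (fun i => let: And4 _ _ _ ldpF := ldpX i in ldpF) (M := M) (M' := M').
(* A real limit [r] is approached by [M = r - e] and [M' = r - e / 2]. For [+oo], every [M] works
   with [M' = M + 1]; for [-oo] the bound is trivial. *)
move: upper; set L := lim _; case: L => [r upper|upper|_]; last exact: leey.
  apply/lee_addgt0Pr => e e0; rewrite -EFinN -EFinD -[(- r + e)%R]opprK.
  apply: (upper _ (r - e / 2)%R); last by rewrite lte_fin gtrBl divr_gt0.
  by rewrite opprD opprK ltrD2l ltrN2 ltr_pdivrMr// ltr_pMr// ltr1n.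
rewrite leeNr leye_eq; apply/eqP/eqyP => M _; rewrite leeNr -EFinN.
by apply: (upper _ (M + 1)); rewrite ?ltry// ltrDl.
Qed.
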